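(* Fix a connected multicyclic graph $H$ and a positive integer $m\ge m_H$. Let $W_n$ be the number of copies of $H$ in the uniform attachment graph $G^m_n$, and let $t\ge0$ be the number of vertices in $H\setminus H'$, where $H'$ is the 2-core of $H$. Then, as $n\to\infty$, $$\mathbb{E}W_n=\Theta\bigl((\log n)^t\bigr),\qquad \mathrm{Var}(W_n)=O\bigl((\log n)^{2t}\bigr).$$
   Context: Uniform attachment graph: for integers $m,n\ge1$, $G^m_n$ is the random loopless multigraph on vertex set $[n]=\{1,\dots,n\}$ in which, for every $j\in\{2,\dots,n\}$ and every label $a\in[m]$, there is exactly one edge $j^{(a)}$ with label $a$ from $j$ to a vertex chosen uniformly at random in $[j-1]$, all choices being independent. Parallel edges are allowed and are distinguished by their labels. $K^m_n$ is the multigraph on $[n]$ having, for every $1\le i<j\le n$, exactly $m$ edges $ji^{(1)},\dots,ji^{(m)}$ between $j$ and $i$; $G^m_n$ is regarded as a random subgraph of $K^m_n$. Graphs are finite and may be loopless multigraphs (a pair of parallel edges is a cycle of length 2). A copy of $H$ in a graph $G$ is a (not necessarily induced) subgraph of $G$ isomorphic to $H$ as an undirected, unlabelled multigraph; two copies are different if they differ as subgraphs (also if they differ only in edge labels). A potential copy of $H$ in $G^m_n$ is a copy of $H$ in $K^m_n$ that does not contain two different edges $ji_1^{(a)}$, $ji_2^{(a)}$ with $i_1,i_2<j$ and the same label $a$. The integer $m_H\ge1$ is such that for $m<m_H$ there are no potential copies of $H$ in $G^m_n$ for any $n$, while for $m\ge m_H$ there are potential copies for all large enough $n$. A graph is multicyclic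 if it has at least two (not necessarily edge- or vertex-disjoint) cycles; it is leaf-free if it has no vertex of degree 1. Every connected multicyclic graph $H$ is obtained from a connected graph $H'$ that is both multicyclic and leaf-free (the 2-core of $H$) by attaching rooted trees $\mathcal{T}_1,\dots,\mathcal{T}_s$ ($s\ge0$), $\mathcal{T}_i$ having $t_i$ edges, at distinct vertices of $H'$, the root of $\mathcal{T}_i$ being identified with the vertex of $H'$; then $t=\sum_i t_i$ (and $H=H'$ when $t=0$). $a_n=\Theta(b_n)$ means that there are constants $0<c\le C<\infty$ not depending on $n$ with $cb_n\le a_n\le Cb_n$ for all sufficiently large $n$. *)

(* Defs.v *)
From mathcomp Require Import reals exp.
From mathcomp Require Import all_boot all_order all_algebra.

Set Implicit Arguments.
Unset Strict Implicit.
Unset Printing Implicit Defensive.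

Import GRing.Theory Num.Theory.

Local Open Scope ring_scope.

(* Parallel edges are different elements of [edge] with the same set of two
   endpoints. *)
Record mgraph := MGraph {
  vert : finType;
  edge : finType;
  ends : edge -> {set vert};
  _ : forall e, #|ends e| = 2 }.

(* Vertex set and edge set.  Such a pair is used below only when it is an actual
   subgraph (the endpoints of its edges lie in the vertex set); for a copy of a
   graph this is forced by [is_copy]. *)
Definition subgraph (G : mgraph) : finType := ({set vert G} * {set edge G})%type.

Definition is_subgraph (G : mgraph) (S : subgraph G) : bool :=
  [forall e in S.2, ends e \subset S.1].

Definition sub_le (G : mgraph) (S S' : subgraph G) : bool :=
  (S.1 \subset S'.1) && (S.2 \subset S'.2).

Definition full (G : mgraph) : subgraph G := ([set: vert G], [set: edge G]).

(* [f] and [g] form an isomorphism from [H] onto the subgraph [S]. *)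
Definition is_copy (H G : mgraph) (S : subgraph G) : bool :=
  [exists f : {ffun vert H -> vert G}, exists g : {ffun edge H -> edge G},
    [&& injectiveb f, f @: [set: vert H] == S.1,
        injectiveb g, g @: [set: edge H] == S.2 &
        [forall e, ends (g e) == f @: ends e]]].

Definition copies (H G : mgraph) (S : subgraph G) : {set subgraph G} :=
  [set S' | sub_le S' S & is_copy H S'].

Definition graph_connected (G : mgraph) : Prop :=
  forall u v : vert G,
    connect (fun x y => [exists e : edge G, ends e == [set x; y]]) u v.

Lemma cycle_endsP (k : nat) (i : 'I_k.+2) : #|[set i; ordS i]| = 2.
Proof.
rewrite cards2; suff -> : i != ordS i by [].
rewrite -val_eqE /=; have := ltn_ord i.
rewrite leq_eqVlt => /predU1P[[->]|lt_ik]; first by rewrite modnn.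
by rewrite modn_small // neq_ltn ltnSn.
Qed.

(* The cycle of length [k + 2]; for [k = 0] this is a pair of parallel edges. *)
Definition cycle_graph (k : nat) : mgraph := MGraph (@cycle_endsP k).

Definition is_cycle (G : mgraph) (S : subgraph G) : Prop :=
  exists k : nat, is_copy (cycle_graph k) S.

Definition multicyclic (G : mgraph) : Prop :=
  exists S1 S2 : subgraph G, [/\ is_cycle S1, is_cycle S2 & S1 != S2].

Definition degree (G : mgraph) (S : subgraph G) (v : vert G) : nat :=
  #|[set e in S.2 | v \in ends e]|.

Definition min_degree2 (G : mgraph) (S : subgraph G) : bool :=
  is_subgraph S && [forall v in S.1, 1 < degree S v]%N.

(* Subgraphs of minimum degree at least 2 are closed under union, so this is the
   largest one. *)
Definition two_core (G : mgraph) : subgraph G :=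
  (\bigcup_(S : subgraph G | min_degree2 S) S.1,
   \bigcup_(S : subgraph G | min_degree2 S) S.2).

(* The vertices 1, ..., n are represented by 0, ..., n-1 in 'I_n.  A slot is a
   pair (j, a) of a vertex other than the first one and a label; since j is
   0-based, the vertices preceding it are exactly the elements of 'I_j. *)
Definition slot (m n : nat) : finType := ({j : 'I_n | 0 < j}%N * 'I_m)%type.

Definition later (m n : nat) (s : slot m n) : 'I_n := val s.1.

(* The edge ji^(a), i < j, of K^m_n. *)
Definition Kedge (m n : nat) : finType := {s : slot m n & 'I_(later s)}.

Definition earlier (m n : nat) (e : Kedge m n) : 'I_n :=
  widen_ord (ltnW (ltn_ord (later (tag e)))) (tagged e).

Lemma Kends_card (m n : nat) (e : Kedge m n) :
  #|[set later (tag e); earlier e]| = 2.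
Proof.
rewrite cards2; suff -> : later (tag e) != earlier e by [].
by rewrite -val_eqE /= neq_ltn (ltn_ord (tagged e)) orbT.
Qed.

Definition K (m n : nat) : mgraph := MGraph (@Kends_card m n).

Definition potential_copy (H : mgraph) (m n : nat) (S : subgraph (K m n)) : Prop :=
  S \in copies H (full (K m n)) /\
  {in S.2 &, injective (fun e : Kedge m n => tag e)}.

Definition is_mH (H : mgraph) (mH : nat) : Prop :=
  [/\ (1 <= mH)%N,
      forall m n : nat, (1 <= m < mH)%N -> (1 <= n)%N ->
        ~ exists S : subgraph (K m n), potential_copy H S &
      forall m : nat, (mH <= m)%N -> exists N : nat, forall n : nat, (N <= n)%N ->
        exists S : subgraph (K m n), potential_copy H S].

(* An outcome assigns to every slot (j, a) the other endpoint of the edge j^(a). *)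
Definition outcome (m n : nat) : finType :=
  {dffun forall s : slot m n, 'I_(later s)}.

Definition UA (m n : nat) (w : outcome m n) : subgraph (K m n) :=
  ([set: 'I_n], [set e : Kedge m n | tagged e == w (tag e)]).

Definition W (H : mgraph) (m n : nat) (w : outcome m n) : nat :=
  #|copies H (UA w)|.

(* Independent uniform choices: the product over the slots (j, a) of the uniform
   probabilities on the predecessors of j; the product does not depend on [w]. *)
Definition prob (R : realType) (m n : nat) (w : outcome m n) : R :=
  \prod_(s : slot m n) (later s)%:R^-1.

Definition expect (R : realType) (m n : nat) (X : outcome m n -> R) : R :=
  \sum_(w : outcome m n) prob R w * X w.

Definition variance (R : realType) (m n : nat) (X : outcome m n -> R) : R :=
  expect (fun w => (X w - expect X) ^+ 2).

Definition EW (R : realType) (H : mgraph) (m n : nat) : R :=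
  expect (fun w : outcome m n => (W H w)%:R).

Definition VarW (R : realType) (H : mgraph) (m n : nat) : R :=
  variance (fun w : outcome m n => (W H w)%:R).

Definition is_Theta (R : realType) (a b : nat -> R) : Prop :=
  exists c C : R, [/\ 0 < c, c <= C &
    exists N : nat, forall n : nat, (N <= n)%N -> c * b n <= a n <= C * b n].

(* Main.v *)
(** Write the vertices as positive integers.  A set [F] of edges of [K m n] is
    contained in the random graph with probability at most the product of the
    [1 / later e] over [e] in [F].  In a connected multicyclic graph every vertex
    set [A] is touched by at least [|A|] edges, and by at least [|A| + 1] edges if
    [A] meets the 2-core; this growth property passes to unions of two copies.
    Summing it over the superlevel sets [A = {v | v > s}] shows that the
    probability is, up to constants, at most the product of [1 / v] over the
    non-core vertices and of [v ^ -(1 + 1/D)] over the core vertices ([D] constant).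
    The latter factors are summable and each of the former contributes a factor
    [log n], whence the upper bounds on [E W] and on [E W ^ 2 >= Var W].  For the
    lower bound, the 2-core of a potential copy is kept fixed and the other vertices
    are put, in reversed peeling order, into consecutive blocks of positions with
    harmonic mass of order [log n]. *)

Require Import Defs.
From mathcomp Require Import classical_sets reals topology normedtype landau exp.
From mathcomp Require Import sequences.
From mathcomp Require Import all_boot all_order all_algebra.
From mathcomp Require Import zify ring lra.
Import Order.TTheory GRing.Theory Num.Theory.
Import numFieldNormedType.Exports.

Set Implicit Arguments.
Unset Strict Implicit.
Unset Printing Implicit Defensive.

(** * Edges touching a vertex set, and peeling to the 2-core *)

Definition touch (G : mgraph) (F : {set edge G}) (A : {set vert G}) : {set edge G} :=
  [set e in F | ends e :&: A != set0].

Lemma ends_card (G : mgraph) (e : edge G) : #|ends e| = 2.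
Proof. by case: G e. Qed.

Lemma touchP (G : mgraph) (F : {set edge G}) (A : {set vert G}) (e : edge G) :
  reflect (e \in F /\ exists2 v, v \in ends e & v \in A) (e \in touch F A).
Proof.
rewrite inE; apply: (iffP andP) => -[eF].
  by case/set0Pn=> v /setIP[]; split=> //; exists v.
by case=> v ve vA; split=> //; apply/set0Pn; exists v; rewrite inE ve.
Qed.

(** Breadth-first search: [d] is the distance to [r], and [p v] is the last edge of a shortest walk
    from [r] to [v]. The edge [e0] is the default value of [p] at [r]. *)
Lemma rooted_parent (G : mgraph) (r : vert G) (e0 : edge G) :
  graph_connected G ->
  exists (d : vert G -> nat) (p : vert G -> edge G),
    forall v, v != r -> exists2 u, ends (p v) = [set v; u] & d u < d v.
Proof.
move=> conG; pose adj x y := [exists e : edge G, ends e == [set x; y]].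
pose reach v l := [exists q : l.-tuple (vert G), path adj r q && (v == last r q)].
have reach_ex v : exists l, reach v l.
  have /connectP[q rq ->] := conG r v.
  by exists (size q); apply/existsP; exists (in_tuple q); rewrite rq eqxx.
pose d v := ex_minn (reach_ex v); exists d.
suff /fin_all_exists[p pP] : forall v, exists e, v != r ->
    exists2 u, ends e = [set v; u] & d u < d v by exists p.
move=> v; have [->|v_r] := eqVneq v r; first by exists e0.
suff [e [u [eE du]]] : exists e u, ends e = [set v; u] /\ d u < d v.
  by exists e; exists u.
rewrite [d v]/d; case: ex_minnP => l /existsP[[q /= /eqP <-]].
case/lastP: q => [|q w] /=; first by rewrite (negPf v_r).
rewrite rcons_path last_rcons size_rcons => /andP[/andP[rq /existsP[e /eqP eE]] /eqP vw] _.
exists e, (last r q); rewrite vw eE setUC; split=> //.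
rewrite /d ltnS; case: ex_minnP => l' _; apply.
by apply/existsP; exists (in_tuple q); rewrite rq eqxx.
Qed.

(** Two vertices with the same parent edge would be parents of each other, so each would be less
    deep than the other. *)
Lemma parent_inj (G : mgraph) (A : {set vert G}) (d : vert G -> nat)
    (p : vert G -> edge G) :
  {in A, forall v, exists2 u, ends (p v) = [set v; u] & d u < d v} ->
  {in A &, injective p}.
Proof.
move=> dp v v' /dp[u eu du] /dp[u' eu' du'] pp.
have := set21 v u; rewrite -eu pp eu' => /set2P[//|vu'].
have := set21 v' u'; rewrite -eu' -pp eu => /set2P[//|v'u].
by move: du du'; rewrite -vu' v'u => /ltn_trans /[apply]; rewrite ltnn.
Qed.

(* The deepest vertex of [A] touched by [F] has only its parent edge. *)
Lemma parent_acyclic (G : mgraph) (A : {set vert G}) (d : vert G -> nat)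
    (p : vert G -> edge G) (F : {set edge G}) :
  {in A, forall v, exists2 u, ends (p v) = [set v; u] & d u < d v} ->
  {in A, forall v, #|[set e in F | v \in ends e]| != 1} ->
  touch F A \subset p @: A -> touch F A = set0.
Proof.
move=> dp degF FA; apply: contraTeq isT => /set0Pn[e /touchP[eF [v0 v0e v0A]]].
pose P v := (v \in A) && [exists e in F, v \in ends e].
have Pv0 : P v0 by rewrite /P v0A; apply/existsP; exists e; rewrite eF.
case: (arg_maxnP d Pv0) => v /andP[vA /existsP[e1 /andP[e1F ve1]]] vmax.
have : 1 < #|[set e in F | v \in ends e]|.
  rewrite ltn_neqAle eq_sym degF //= card_gt0; apply/set0Pn.
  by exists e1; rewrite inE e1F.
case/card_gt1P=> a [b []]; rewrite !inE => /andP[aF va] /andP[bF vb] ab.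
(* At least two edges of [F] meet [v], so one of them, [c], is not its parent edge. Being the parent
   edge of another vertex [u], it makes [u] a touched vertex deeper than [v]. *)
have [c [cF vc cv]] : exists c, [/\ c \in F, v \in ends c & c != p v].
  by have [av|] := eqVneq a (p v); [exists b; rewrite eq_sym -av|exists a].
have /(subsetP FA)/imsetP[u uA cu] : c \in touch F A.
  by apply/touchP; split=> //; exists v.
have [w pu dw] := dp u uA.
have : v \in [set u; w] by rewrite -pu -cu.
case/set2P=> [vu|vw]; first by rewrite cu vu eqxx in cv.
have /vmax : P u.
  by rewrite /P uA; apply/existsP; exists c; rewrite cF cu pu set21.
by rewrite /= vw; move: dw; rewrite ltnNge => /negPf ->.
Qed.

(** * Cycles and the edge count of multicyclic graphs *)

Lemma copy_degree (H G : mgraph) (S : subgraph G) (f : vert H -> vert G)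
    (g : edge H -> edge G) (u : vert H) :
  injective f -> injective g -> g @: [set: edge H] = S.2 ->
  (forall e, ends (g e) = f @: ends e) ->
  degree S (f u) = degree (full H) u.
Proof.
move=> finj ginj gS fg; rewrite /degree -gS.
rewrite -(card_imset [set e in (full H).2 | u \in ends e] ginj); apply: eq_card => e.
rewrite inE; apply/andP/imsetP => [[/imsetP[e' _ ->]]|[e' + ->]].
  by rewrite fg mem_imset // => ue; exists e' => //; rewrite !inE.
by rewrite inE fg (mem_imset _ _ finj) => /andP[_ ->]; rewrite imset_f ?inE.
Qed.

Lemma cycle_degree (G : mgraph) (S : subgraph G) (v : vert G) :
  is_cycle S -> degree S v = if v \in S.1 then 2 else 0.
Proof.
case=> k /existsP[f /existsP[g /and5P[/injectiveP fi /eqP fS /injectiveP gi /eqP gS /forallP fg]]].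
have {}fg e : ends (g e) = f @: ends e by apply/eqP.
case: ifPn => [|vS].
  rewrite -fS => /imsetP[i _ ->].
  rewrite (copy_degree i fi gi gS fg) /degree /=.
  (* Edge [j] of the cycle graph joins [j] to its successor, so the edges at [i] are [i] and its
     predecessor. *)
  rewrite (_ : [set e in _ | _] = [set i; ord_pred i]).
    have := cycle_endsP (ord_pred i); rewrite cards2 ord_predK eq_sym cards2.
    by case: eqP.
  apply/setP=> e; rewrite !inE /= eq_sym; congr (_ || _).
  by rewrite eq_sym (can2_eq (@ordSK _) (@ord_predK _)).
apply/eqP; rewrite cards_eq0; apply/eqP/setP=> e; rewrite !inE.
apply: contraNF vS => /andP[]; rewrite -gS => /imsetP[i _ ->].
by rewrite fg -fS => /imsetP[j _ ->]; apply: imset_f.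
Qed.

Lemma cycle_neq0 (G : mgraph) (S : subgraph G) : is_cycle S -> S.2 != set0.
Proof.
case=> k /existsP[f /existsP[g /and5P[_ _ _ /eqP <- _]]].
by apply/set0Pn; exists (g ord0); apply: imset_f.
Qed.

(** The vertices of a cycle are exactly those at which its edge set has nonzero degree. *)
Lemma cycle_inj (G : mgraph) (S1 S2 : subgraph G) :
  is_cycle S1 -> is_cycle S2 -> S1.2 = S2.2 -> S1 = S2.
Proof.
case: S1 S2 => [V1 E1] [V2 E2] c1 c2 /= E12; subst E2; congr (_, _).
apply/setP=> v; have := cycle_degree v c1; rewrite /degree /=.
by have := cycle_degree v c2; rewrite /degree /= => ->; do 2!case: ifP.
Qed.

(** All degrees in a cycle are 0 or 2, so the degrees in the symmetric difference are even. *)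
Lemma symdiff_degree (G : mgraph) (S1 S2 : subgraph G) (v : vert G) :
  is_cycle S1 -> is_cycle S2 ->
  #|[set e in (S1.2 :\: S2.2) :|: (S2.2 :\: S1.2) | v \in ends e]| != 1.
Proof.
move=> c1 c2; have := cycle_degree v c1; have := cycle_degree v c2.
rewrite /degree; set D1 := [set e in S1.2 | _]; set D2 := [set e in S2.2 | _].
rewrite (_ : [set e in _ | _] = (D1 :\: D2) :|: (D2 :\: D1)); last first.
  by apply/setP=> e; rewrite !inE; do 3!case: (_ \in _).
have /eqP := cardsUI (D1 :\: D2) (D2 :\: D1).
rewrite (_ : _ :&: (D2 :\: D1) = set0) ?cards0; last first.
  by apply/setP=> e; rewrite !inE; do 3!case: (_ \in _).
have := cardsID D1 D2; have := cardsID D2 D1; rewrite setIC.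
by do 2!case: ifP; lia.
Qed.

(** A spanning tree has [|V| - 1] edges, and two different cycles force at least two edges outside
    it. *)
Lemma multicyclic_card (G : mgraph) :
  graph_connected G -> multicyclic G -> #|vert G| < #|edge G|.
Proof.
move=> conG [S1 [S2 [c1 c2 S12]]].
have [e0 _] := set0Pn _ (cycle_neq0 c1).
have [r _] : exists r : vert G, r \in ends e0.
  by apply/set0Pn; rewrite -card_gt0 ends_card.
have [d [p dp]] := rooted_parent r e0 conG.
pose A := ~: [set r]; pose P := p @: A.
have {}dp : {in A, forall v, exists2 u, ends (p v) = [set v; u] & d u < d v}.
  by move=> v; rewrite !inE; apply: dp.
(* A nonempty leaf-free edge set cannot lie in the tree: each of its edges has an endpoint other
   than the root, so [parent_acyclic] applies. *)
have noncyc (F : {set edge G}) : F != set0 ->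
    (forall v, #|[set e in F | v \in ends e]| != 1) -> exists2 e, e \in F & e \notin P.
  move=> /set0Pn[e eF] degF; apply/subsetPn/negP => FP.
  have : e \in touch F A.
    apply/touchP; split=> //.
    have /cards2P[x [y [xy eE]]] : #|ends e| == 2 by rewrite ends_card.
    have [xr|xr] := eqVneq x r.
      by exists y; rewrite ?eE ?set22 // !inE -xr eq_sym.
    by exists x; rewrite ?eE ?set21 // !inE.
  rewrite (parent_acyclic dp) ?inE //.
  by apply: subset_trans FP; apply/subsetP=> x /touchP[].
have cP : #|P| = #|vert G|.-1.
  rewrite card_in_imset; last exact: parent_inj dp.
  by rewrite cardsC1.
have cyc (S : subgraph G) : is_cycle S -> exists2 e, e \in S.2 & e \notin P.
  move=> c; apply: noncyc; first exact: cycle_neq0.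
  by move=> v; have := cycle_degree v c; rewrite /degree => ->; case: ifP.
have : 1 < #|~: P|.
  have [e1 e1S e1P] := cyc _ c1; have [e2 e2S e2P] := cyc _ c2.
  have [e12|ne] := eqVneq e1 e2; last first.
    by apply/card_gt1P; exists e1, e2; rewrite !inE.
  (* If both cycles leave the tree through the same edge, that edge is not in the symmetric
     difference, which must supply another one. *)
  have [||e3 e3S e3P] := noncyc ((S1.2 :\: S2.2) :|: (S2.2 :\: S1.2)).
  - apply: contraNneq S12 => /eqP; rewrite setU_eq0 !setD_eq0 => E12.
    by apply/eqP/cycle_inj => //; apply/eqP; rewrite eqEsubset.
  - by move=> v; apply: symdiff_degree.
  apply/card_gt1P; exists e1, e3; rewrite !inE e1P e3P; split=> //.
  by apply: contraTneq e3S => <-; rewrite !inE e1S e12 e2S.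
have := cardsC P; rewrite cP.
have : 0 < #|vert G| by apply/card_gt0P; exists r.
lia.
Qed.

(** * The 2-core *)

Lemma two_core_degree (G : mgraph) (v : vert G) :
  v \in (two_core G).1 -> 1 < degree (two_core G) v.
Proof.
case/bigcupP=> S mS vS; have /andP[_ /forall_inP/(_ v vS)] := mS.
move/leq_trans; apply; apply/subset_leq_card/subsetP=> e; rewrite !inE.
by case/andP=> eS ->; rewrite andbT; apply/bigcupP; exists S.
Qed.

Lemma two_core_ends (G : mgraph) (e : edge G) :
  e \in (two_core G).2 -> ends e \subset (two_core G).1.
Proof.
case/bigcupP=> S mS eS; have /andP[/forall_inP/(_ e eS) eS1 _] := mS.
by apply: subset_trans eS1 _; apply: bigcup_sup.
Qed.

(* If equality held, all edges touching [A] would be parent edges for a root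
   outside [A], although every core vertex has two core edges. *)
Lemma touch_card (G : mgraph) (A : {set vert G}) :
  graph_connected G -> multicyclic G ->
  #|A| + (A :&: (two_core G).1 != set0) <= #|touch [set: edge G] A|.
Proof.
move=> conG mG; have [e0 _] : exists e0 : edge G, true.
  by case: mG => S1 [_ [/cycle_neq0/set0Pn[e0 _] _ _]]; exists e0.
(* If no vertex outside [A] is available as a root, the bound is [|V| < |E|]. *)
have [AT|/subsetPn[r _ rA]] := boolP ([set: vert G] \subset A).
  have -> : A = setT by apply/eqP; rewrite eqEsubset subsetT.
  rewrite cardsT (_ : touch _ _ = setT); last first.
    by apply/setP=> e; rewrite !inE setIT -card_gt0 ends_card.
  have := multicyclic_card conG mG; rewrite cardsT.
  by case: (_ != _); lia.
have [d [p dp]] := rooted_parent r e0 conG.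
have {}dp : {in A, forall v, exists2 u, ends (p v) = [set v; u] & d u < d v}.
  by move=> v vA; apply: dp; apply: contraNneq rA => <-.
have PT : p @: A \subset touch setT A.
  apply/subsetP=> _ /imsetP[v vA ->]; apply/touchP; split=> //; exists v => //.
  by have [u -> _] := dp v vA; rewrite set21.
have cP : #|p @: A| = #|A| by rewrite card_in_imset //; apply: parent_inj dp.
have := subset_leq_card PT; rewrite cP leq_eqVlt => /predU1P[eqA|]; last first.
  by case: (_ != _); lia.
have PE : p @: A = touch setT A by apply/eqP; rewrite eqEcard PT cP eqA leqnn.
rewrite -eqA; case: eqVneq => [_|/set0Pn[v /setIP[vA vC]]]; first by rewrite addn0.
have deg := two_core_degree vC.
have [e] : exists e, e \in [set e in (two_core G).2 | v \in ends e].
  by apply/set0Pn; rewrite -card_gt0 (ltn_trans _ deg).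
rewrite inE => /andP[eC ve].
have : e \in touch (two_core G).2 A by apply/touchP; split=> //; exists v.
rewrite (parent_acyclic dp) ?inE //.
  move=> w wA; have [wC|wC] := boolP (w \in (two_core G).1).
    by rewrite neq_ltn two_core_degree ?orbT.
  rewrite (_ : [set _ in _ | _] = set0) ?cards0 //; apply/setP=> x; rewrite !inE.
  by apply: contraNF wC => /andP[/two_core_ends/subsetP]; apply.
by rewrite PE; apply/subsetP=> x /touchP[_ xA]; apply/touchP.
Qed.

(* Peeling: removing vertices of degree at most 1 one after another, in
   decreasing order of [rho], leaves the 2-core. *)
Lemma peeling (G : mgraph) (B : {set vert G}) :
  (two_core G).1 \subset B ->
  exists rho : vert G -> nat,
    [/\ {in B :\: (two_core G).1, forall v, rho v < #|B :\: (two_core G).1|},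
        {in B :\: (two_core G).1 &, injective rho} &
        {in B :\: (two_core G).1, forall v,
          #|[set e | [&& v \in ends e, ends e \subset B &
              [forall u in ends e :\: (two_core G).1, rho u <= rho v]]]| <= 1}].
Proof.
set C := (two_core G).1.
have [n] := ubnP #|B|; elim: n B => // n IHn B ltBn CB.
have [BC|/set0Pn[x0 x0B]] := eqVneq (B :\: C) set0.
  by exists (fun=> 0); split=> v; rewrite BC inE.
(* Otherwise the subgraph induced on [B] would have minimum degree at least 2, and [B] would lie in
   the 2-core. *)
have /existsP[v /and3P[vB vC vdeg]] : [exists v, [&& v \in B, v \notin C &
    #|[set e | (v \in ends e) && (ends e \subset B)]| <= 1]].
  apply: contraT; rewrite negb_exists => /forallP noB.
  pose S : subgraph G := (B, [set e | ends e \subset B]).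
  suff mS : min_degree2 S.
    have /subsetP BC : B \subset C by apply: (bigcup_sup S mS).
    by case/setDP: x0B => /BC ->.
  apply/andP; split; first by apply/forall_inP=> e; rewrite inE.
  apply/forall_inP=> v vB; rewrite /degree /=.
  have [vC|vC] := boolP (v \in C).
    apply: leq_trans (two_core_degree vC) _; apply/subset_leq_card/subsetP => e.
    rewrite !inE => /andP[/two_core_ends eC ->]; rewrite andbT.
    exact: subset_trans eC CB.
  have := noB v; rewrite vB vC /= -ltnNge => /leq_trans; apply.
  by apply/subset_leq_card/subsetP => e; rewrite !inE andbC.
have vBC : v \in B :\: C by rewrite inE vC.
have CB' : C \subset B :\ v by rewrite subsetD1 CB.
have ltB : #|B :\ v| < n by have := cardsD1 v B; rewrite vB; lia.
have [rho [rho_lt rho_inj rho_deg]] := IHn _ ltB CB'.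
have BvC : (B :\ v) :\: C = (B :\: C) :\ v.
  by apply/setP=> x; rewrite !inE andbCA.
have cBC : #|B :\: C| = #|(B :\ v) :\: C|.+1 by rewrite BvC (cardsD1 v) vBC.
rewrite BvC in rho_lt rho_inj rho_deg.
(* The vertex removed first receives the top rank; the others are ranked recursively. *)
pose rho' x := if x == v then #|(B :\: C) :\ v| else rho x.
exists rho'; split.
- move=> x xB; rewrite cBC BvC ltnS /rho'; case: eqP => // /eqP xv.
  by apply/ltnW/rho_lt; rewrite in_setD1 xv.
- move=> x y xB yB; rewrite /rho'; case: (eqVneq x v) => [->|xv]; case: (eqVneq y v) => [->|yv] //.
  + have := rho_lt y; rewrite in_setD1 yv yB => /(_ isT) + E.
    by rewrite -E ltnn.
  + have := rho_lt x; rewrite in_setD1 xv xB => /(_ isT) + E.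
    by rewrite E ltnn.
  + by apply: rho_inj; rewrite in_setD1 ?xv ?yv.
- move=> x xB; case: (eqVneq x v) => [->|xv].
    apply: leq_trans vdeg; apply/subset_leq_card/subsetP=> e.
    by rewrite !inE => /and3P[-> ->].
  have xB' : x \in (B :\: C) :\ v by rewrite in_setD1 xv.
  apply: leq_trans (rho_deg x xB'); apply/subset_leq_card/subsetP=> e.
  rewrite !inE => /and3P[-> eB /forall_inP rhoe] /=.
  (* The vertex [v] outranks [x], so an edge at [x] without a higher-ranked non-core endpoint avoids
     [v] and is counted by the induction hypothesis. *)
  have ve : v \notin ends e.
    apply/negP=> ve; have := rhoe v; rewrite inE vC ve => /(_ isT).
    by rewrite /rho' eqxx (negPf xv) leqNgt rho_lt.
  rewrite subsetD1 eB ve /=; apply/forall_inP=> u ueC; have := rhoe u ueC.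
  rewrite /rho' (negPf xv); case: eqP => // uv.
  by case/setDP: ueC; rewrite uv (negPf ve).
Qed.

(** * Expectations *)

Local Open Scope ring_scope.

(** Vertices being numbered from 0, [later] of a slot is also the number of its possible targets, so
    each factor is the probability of one edge. *)
Definition wt (R : realType) (m n : nat) (F : {set Kedge m n}) : R :=
  \prod_(e in F) (later (tag e))%:R^-1.

Lemma later_gt0 (m n : nat) (s : slot m n) : (0 < later s)%N.
Proof. exact: valP s.1. Qed.

Lemma wt_ge0 (R : realType) (m n : nat) (F : {set Kedge m n}) : 0 <= wt R F.
Proof. by apply: prodr_ge0 => e _; rewrite invr_ge0. Qed.

(** The edges of [F] occupy distinct slots, so the event fixes independent choices at these slots
    and leaves the other slots free. *)
Lemma expect_sub (R : realType) (m n : nat) (F : {set Kedge m n}) :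
  {in F &, injective (fun e : Kedge m n => tag e)} ->
  expect (fun w : outcome m n => (F \subset (UA w).2)%:R) = wt R F.
Proof.
move=> tagF; rewrite /expect /prob.
(* [Q s] is the set of targets that [F] allows at [s]: a single one if an edge of [F] uses [s], and
   all of them otherwise. *)
pose Q (s : slot m n) : pred 'I_(later s) :=
  fun i => [forall e in F, (tag e == s) ==> (e == existT _ s i)].
have cQ s : (#|Q s|%:R * (later s)%:R^-1 : R) =
    if s \in [set tag e | e in F] then (later s)%:R^-1 else 1.
  case: ifPn => [/imsetP[[s0 i0] eF /= ->]|sF].
    rewrite (_ : #|Q s0| = 1%N) ?mul1r // -(card1 i0); apply: eq_card => i.
    rewrite !unfold_in /=; apply/forall_inP/eqP => [/(_ _ eF)|-> e eF'].
      by rewrite /= eqxx /= eq_Tagged /= => /eqP.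
    by apply/implyP => /eqP te; apply/eqP/tagF.
  rewrite (_ : #|Q s| = later s); last first.
    rewrite -[RHS]card_ord; apply: eq_card => i; rewrite !unfold_in /=.
    apply/forall_inP => e eF; apply/implyP => /eqP te.
    by case/negP: sF; rewrite -te; apply: imset_f.
  by rewrite divff // pnatr_eq0 -lt0n later_gt0.
rewrite -big_distrr /=.
(* All outcomes are equally likely, so it suffices to count those containing [F], which form the
   product of the [Q s]. *)
have -> : \sum_(w : outcome m n) (F \subset (UA w).2)%:R =
    #|(family Q : simpl_pred (outcome m n))|%:R :> R.
  rewrite -sum1_card natr_sum [RHS]big_mkcond; apply: eq_bigr => w _.
  suff -> : (w \in family Q) = (F \subset (UA w).2) by case: (_ \subset _).
  apply/familyP/subsetP => [Qw e eF|FU s]; last first.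
    apply/forall_inP=> e eF; apply/implyP=> /eqP <-.
    have := FU e eF; rewrite inE => /eqP <-.
    by apply/eqP; case: (e).
  have /forall_inP/(_ e eF) := Qw (tag e); rewrite eqxx /= => we.
  by rewrite inE -eq_Tagged.
rewrite card_family foldrE big_map big_enum /= natr_prod mulrC -big_split /=.
under eq_bigr do rewrite cQ.
by rewrite -big_mkcond /= big_imset.
Qed.

Lemma expect_sub_noninj (R : realType) (m n : nat) (F : {set Kedge m n}) :
  ~ {in F &, injective (fun e : Kedge m n => tag e)} ->
  expect (fun w : outcome m n => (F \subset (UA w).2)%:R) = 0 :> R.
Proof.
move=> tagF; rewrite /expect big1 // => w _.
case: (boolP (F \subset _)) => [/subsetP FU|_]; last by rewrite mulr0.
case: tagF => -[s i] [s' i'] /FU + /FU; rewrite !inE /= => /eqP -> /eqP -> ss'.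
by subst s'.
Qed.

Lemma expect_sub_le (R : realType) (m n : nat) (F : {set Kedge m n}) :
  expect (fun w : outcome m n => (F \subset (UA w).2)%:R) <= wt R F.
Proof.
have [/forall_inP tagF|] := boolP [forall e in F, forall e' in F, (tag e == tag e') ==> (e == e')].
  rewrite expect_sub // => e e' eF e'F /eqP te.
  by have /forall_inP/(_ e' e'F) := tagF e eF; rewrite te => /eqP.
move=> /negP tagF; rewrite expect_sub_noninj ?wt_ge0 // => inj; case: tagF.
apply/forall_inP=> e eF; apply/forall_inP=> e' e'F; apply/implyP => /eqP te.
exact/eqP/inj.
Qed.

Lemma expect1 (R : realType) (m n : nat) : expect (fun _ : outcome m n => 1) = 1 :> R.
Proof.
have E := @expect_sub R m n set0.
rewrite /wt big_set0 in E; rewrite -[RHS]E; last by move=> e e'; rewrite inE.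
by apply: eq_bigr => w _; rewrite sub0set.
Qed.

Lemma expect_sum (R : realType) (m n : nat) (I : finType) (P : pred I)
    (X : I -> outcome m n -> R) :
  expect (fun w => \sum_(i | P i) X i w) = \sum_(i | P i) expect (X i).
Proof.
rewrite /expect; under eq_bigr do rewrite big_distrr.
exact: exchange_big.
Qed.

Lemma WE (R : realType) (H : mgraph) (m n : nat) (w : outcome m n) :
  (W H w)%:R = \sum_(S : subgraph (K m n) | is_copy H S) (S.2 \subset (UA w).2)%:R :> R.
Proof.
rewrite /W -sum1_card natr_sum big_mkcond [RHS]big_mkcond; apply: eq_bigr => S _.
by rewrite inE /sub_le subsetT /=; case: (is_copy H S); case: (_ \subset _).
Qed.

Lemma EWE (R : realType) (H : mgraph) (m n : nat) :
  EW R H m n = \sum_(S : subgraph (K m n) | is_copy H S)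
    expect (fun w : outcome m n => (S.2 \subset (UA w).2)%:R).
Proof.
by rewrite -expect_sum; apply: eq_bigr => w _; rewrite WE.
Qed.

Lemma variance_le (R : realType) (m n : nat) (X : outcome m n -> R) :
  0 <= variance X <= expect (fun w => X w ^+ 2).
Proof.
apply/andP; split.
  apply: sumr_ge0 => w _; rewrite mulr_ge0 ?sqr_ge0 //.
  by apply: prodr_ge0 => s _; rewrite invr_ge0.
have -> : variance X = expect (fun w => X w ^+ 2) - expect X ^+ 2.
  rewrite /variance; move Ea : (expect X) => a.
  have -> : expect (fun w => (X w - a) ^+ 2) = expect (fun w => X w ^+ 2) -
      a *+ 2 * expect X + a ^+ 2 * expect (fun _ : outcome m n => 1).
    rewrite /expect !mulr_sumr -sumrN -!big_split /=; apply: eq_bigr => w _.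
    by ring.
  by rewrite expect1 Ea; ring.
by rewrite gerBl sqr_ge0.
Qed.

(** The square of the count runs over pairs of copies, and two copies are present together exactly
    when the union of their edge sets is. Dropping [(E W)^2] is affordable because the target has
    the same order. *)
Lemma VarW_le (R : realType) (H : mgraph) (m n : nat) :
  0 <= VarW R H m n <=
  \sum_(S : subgraph (K m n) * subgraph (K m n) | is_copy H S.1 && is_copy H S.2)
    wt R (S.1.2 :|: S.2.2).
Proof.
have /andP[-> /le_trans] := variance_le (fun w : outcome m n => (W H w)%:R : R).
apply.
have -> : expect (fun w : outcome m n => (W H w)%:R ^+ 2) =
  \sum_(S : subgraph (K m n) * subgraph (K m n) | is_copy H S.1 && is_copy H S.2)
    expect (fun w : outcome m n => (S.1.2 :|: S.2.2 \subset (UA w).2)%:R : R).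
  rewrite -expect_sum; apply: eq_bigr => w _; rewrite WE expr2 big_distrlr /=.
  rewrite pair_big /=; congr (_ * _); apply: eq_bigr => S _.
  by rewrite subUset -natrM mulnb.
by apply: ler_sum => S _; apply: expect_sub_le.
Qed.

(** * Upper bounds *)

(** This is [ln (1 - x) <= - x] at [x = 1 / (n + 2)]. *)
Lemma lnS_diff (R : realType) (n : nat) : n.+2%:R^-1 <= ln n.+2%:R - ln n.+1%:R :> R.
Proof.
have n2 : (0 : R) < n.+2%:R by rewrite ltr0n.
have n1 : (0 : R) < n.+1%:R by rewrite ltr0n.
rewrite -[leLHS]opprK -[leRHS]opprB lerN2 -ln_div ?posrE //.
have -> : n.+1%:R / n.+2%:R = 1 + - n.+2%:R^-1 :> R.
  by rewrite -[n.+2]addn1 natrD -[X in X / _](addrK 1) mulrBl divff ?mul1r // natr1 pnatr_eq0.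
by apply: le_ln1Dx; rewrite ltrN2 invf_lt1 // ltr1n.
Qed.

Lemma harmonic_le (R : realType) (n : nat) :
  \sum_(i < n.+1) i.+1%:R^-1 <= 1 + ln n.+1%:R :> R.
Proof.
elim: n => [|n IHn]; first by rewrite big_ord1 invr1 ln1 addr0.
rewrite big_ord_recr /=; apply: le_trans (lerD IHn (lnS_diff R n)) _.
by rewrite addrACA; lra.
Qed.

(** The power [(i + 1) ^ - (1 + 1 / D)], written as an exponential to suit arguments by
    logarithms. *)
Definition damped (R : realType) (D i : nat) : R :=
  expR (- (1 + D%:R^-1) * ln i.+1%:R).

(* With [y i = (i+1)^(1/D)] the terms are at most [D (1 / y i - 1 / y (i+1))]. *)
Lemma damped_sum (R : realType) (D n : nat) : (0 < D)%N ->
  \sum_(i < n) damped R D i <= 1 + D%:R.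
Proof.
move=> D0; have D0' : (0 : R) < D%:R by rewrite ltr0n.
pose y i : R := expR (- (D%:R^-1 * ln i.+1%:R)).
suff H : \sum_(i < n.+1) damped R D i <= 1 + D%:R * (1 - y n).
  have := expR_gt0 (- (D%:R^-1 * ln n.+1%:R : R)); rewrite -/(y n) => yn.
  have : 0 <= damped R D n by apply: expR_ge0.
  rewrite big_ord_recr /= in H; have : 0 <= D%:R * y n by rewrite mulr_ge0 ?ltW.
  lra.
elim: n => [|n IHn].
  by rewrite big_ord1 /damped /y ln1 !mulr0 oppr0 expR0; lra.
rewrite big_ord_recr /=.
suff : damped R D n.+1 <= D%:R * (y n - y n.+1) by lra.
have -> : y n = y n.+1 * expR (D%:R^-1 * (ln n.+2%:R - ln n.+1%:R)).
  by rewrite /y -expRD; congr expR; ring.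
have -> : damped R D n.+1 = y n.+1 * n.+2%:R^-1.
  rewrite /damped -[in RHS](@lnK _ n.+2%:R) ?posrE ?ltr0n // -expRN -expRD.
  by congr expR; ring.
rewrite -[X in _ - X]mulr1 -mulrBr mulrCA ler_pM2l ?expR_gt0 //.
apply: le_trans (lnS_diff R n) _.
have := expR_ge1Dx (D%:R^-1 * (ln n.+2%:R - ln n.+1%:R) : R).
set z := ln _ - _; set E := expR _ => zE.
have -> : z = D%:R * (D%:R^-1 * z) by rewrite mulVKf ?gt_eqF.
by rewrite ler_pM2l //; lra.
Qed.

(** Induction on [t]: in the step to [t + 1], a nonempty [Z] is counted once for each of its
    elements [i], and removing [i] leaves at most [t] elements. *)
Lemma small_sets_sum (R : numDomainType) (I : finType) (x : I -> R) (t : nat) :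
  (forall i, 0 <= x i) ->
  \sum_(Z : {set I} | (#|Z| <= t)%N) \prod_(i in Z) x i <= (1 + \sum_i x i) ^+ t.
Proof.
move=> x0; have s0 : 0 <= \sum_i x i by apply: sumr_ge0.
have p0 (Z : {set I}) : 0 <= \prod_(i in Z) x i by apply: prodr_ge0.
elim: t => [|t IHt].
  rewrite (big_pred1 set0) ?big_set0 ?expr0 // => Z.
  by rewrite leqn0 cards_eq0.
rewrite exprS mulrDl mul1r (bigD1 set0) ?cards0 //= big_set0.
apply: lerD; first by apply: exprn_ege1; rewrite lerDl.
apply: le_trans (_ : \sum_(Z : {set I} | (#|Z| <= t.+1)%N) \sum_(i in Z) \prod_(j in Z) x j <= _).
  rewrite big_mkcondr /=; apply: ler_sum => Z _; case: ifPn => [/set0Pn[i iZ]|_].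
    by rewrite [leRHS](bigD1 i) //= lerDl sumr_ge0.
  by apply: sumr_ge0.
rewrite (exchange_big_dep xpredT) //= mulr_suml; apply: ler_sum => i _.
apply: le_trans (ler_wpM2l (x0 i) IHt); rewrite mulr_sumr.
rewrite (reindex_onto (fun Z : {set I} => i |: Z) (fun Z => Z :\ i)) /=; last first.
  by move=> Z /andP[_ iZ]; rewrite setD1K.
rewrite [leLHS]big_mkcond [leRHS]big_mkcond /=; apply: ler_sum => Z _.
case: ifP => [/andP[/andP[ct _] /eqP EZ]|_]; last by case: ifP => // _; rewrite mulr_ge0.
have iZ : i \notin Z by rewrite -EZ !inE eqxx.
have -> : (#|Z| <= t)%N by move: ct; rewrite cardsU1 iZ.
by rewrite big_setU1.
Qed.

(** Telescoping from [ln 1 = 0]. The indicator makes the range of [s] independent of [i], so that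
    sums over vertices and over thresholds can be exchanged. *)
Lemma layer_cake (R : realType) (n : nat) (i : 'I_n) :
  ln i.+1%:R = \sum_(s < n) (s < i)%N%:R * (ln s.+2%:R - ln s.+1%:R) :> R.
Proof.
transitivity (\sum_(s < n | (s < i)%N) (ln s.+2%:R - ln s.+1%:R) : R); last first.
  rewrite big_mkcond; apply: eq_bigr => s _.
  by case: ifP; rewrite ?mul1r ?mul0r.
rewrite -(big_ord_widen _ (fun s => ln s.+2%:R - ln s.+1%:R)) ?(ltnW (ltn_ord i)) //.
rewrite -(big_mkord predT (fun s => ln s.+2%:R - ln s.+1%:R)).
by rewrite (telescope_sumr (fun s => ln s.+1%:R)) // ln1 subr0.
Qed.

(* [C] and [Z] stand for the core and the non-core vertices of [U]; unlike being
   a copy of a multicyclic graph, this property is stable under unions. *)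
Definition good (m n k t q : nat) (U : subgraph (K m n)) (Z C : {set 'I_n}) : bool :=
  [&& is_subgraph U, U.1 == Z :|: C, [disjoint Z & C], #|Z| <= t, #|C| <= k,
      #|U.2| <= q &
      [forall A : {set 'I_n}, (A \subset U.1) ==>
        (#|A| + (A :&: C != set0) <= #|touch U.2 A|)]]%N.

Lemma touch_later (m n s : nat) (F : {set Kedge m n}) (A : {set 'I_n}) :
  (forall v, v \in A -> s < v)%N ->
  touch (F : {set edge (K m n)}) A \subset [set e in F | (s < later (tag e))%N].
Proof.
move=> As; apply/subsetP=> e /touchP[eF [v ve vA]]; rewrite inE eF /=.
have {As}sv := As v vA; move: ve; rewrite !inE => /orP[]/eqP ve; subst v => //.
exact: ltn_trans sv (ltn_ord (tagged e)).
Qed.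

Lemma wt_good (R : realType) (m n k t q : nat) (U : subgraph (K m n))
    (Z C : {set 'I_n}) : good k t q U Z C ->
  wt R U.2 <= 2 ^+ q * ((\prod_(v in Z) v.+1%:R^-1) * \prod_(v in C) damped R k.+1 v).
Proof.
case/and5P=> _ /eqP U1 ZC Zt /and3P[Ck Uq /forallP grow].
pose L (i : nat) : R := ln i.+1%:R.
(* Expand [ln v.+1] as a sum over thresholds [s < v] and use the growth property
   for the set of vertices of [U] above [s]. *)
have logs : \sum_(v in Z) L v + (1 + k.+1%:R^-1) * \sum_(v in C) L v <=
    \sum_(e in U.2) L (later (tag e)).
  have count (T : finType) (P : {set T}) (f : T -> 'I_n) :
      \sum_(x in P) L (f x) =
      \sum_(s < n) #|[set x in P | (s < f x)%N]|%:R * (ln s.+2%:R - ln s.+1%:R).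
    under eq_bigr do rewrite /L layer_cake.
    rewrite exchange_big /=; apply: eq_bigr => s _.
    rewrite -mulr_suml; congr (_ * _).
    rewrite -sum1_card natr_sum big_mkcond [RHS]big_mkcond /=.
    by apply: eq_bigr => x _; rewrite inE; case: (x \in P); case: (_ < _)%N.
  rewrite !(count _ _ id) (count _ U.2 (fun e : Kedge m n => later (tag e))).
  rewrite mulr_sumr -big_split /=; apply: ler_sum => s _.
  rewrite mulrA -mulrDl; apply: ler_wpM2r.
    by apply: le_trans (lnS_diff R s); rewrite invr_ge0.
  set Zs := [set x in Z | _]; set Cs := [set x in C | _].
  have Cs0 : [disjoint Zs & Cs].
    by apply: disjointW ZC; apply/subsetP=> x; rewrite inE => /andP[].
  have As v : v \in Zs :|: Cs -> (s < v)%N.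
    by rewrite !inE => /orP[]/andP[].
  have AU : Zs :|: Cs \subset U.1.
    by rewrite U1; apply: setUSS; apply/subsetP=> x; rewrite inE => /andP[].
  have := implyP (grow (Zs :|: Cs)) AU.
  move/leq_trans/(_ (subset_leq_card (@touch_later m n s U.2 _ As))).
  rewrite cardsU disjoint_setI0 // cards0 subn0.
  have -> : (Zs :|: Cs) :&: C = Cs.
    rewrite setIUl disjoint_setI0 ?set0U; last first.
      by apply: disjointWl ZC; apply/subsetP=> x; rewrite inE => /andP[].
    by apply/setIidPl/subsetP=> x; rewrite inE => /andP[].
  rewrite -(ler_nat R) !natrD; apply: le_trans; rewrite mulrDl mul1r -!addrA !lerD2l.
  (* The one extra edge gained when the core is met is shared by at most [k] core vertices, which
     justifies the surplus [1 / (k + 1)] in the exponent of each. *)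
  have [->|Csn0] := eqVneq Cs set0; first by rewrite cards0 mulr0.
  rewrite /= ler_pdivrMl ?ltr0n // mulr1 ler_nat (leq_trans _ (leqnSn k)) //.
  by apply: leq_trans Ck; apply/subset_leq_card/subsetP=> x; rewrite inE => /andP[].
have lnV_expR (i : nat) : i.+1%:R^-1 = expR (- L i) by rewrite expRN lnK ?posrE ?ltr0n.
(* A later endpoint [l] is at least 1, so [1 / l <= 2 / (l + 1)]. This shift by one, which gives the
   vertex 0 a finite weight, accounts for [2 ^ q]. *)
apply: le_trans (_ : 2 ^+ #|U.2| * \prod_(e in U.2) (later (tag e)).+1%:R^-1 <= _).
  rewrite -prodr_const -big_split /=; apply: ler_prod => e _.
  rewrite invr_ge0 ler0n /= ler_pdivlMr ?ltr0n // ler_pdivrMl ?ltr0n ?later_gt0 //.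
  rewrite -natrM ler_nat.
  move: (later_gt0 (tag e)). move: (nat_of_ord _) => l; lia.
apply: ler_pM; rewrite ?exprn_ge0 //.
- by apply: prodr_ge0 => e _; rewrite invr_ge0.
- by rewrite ler_weXn2l // ler1n.
under eq_bigr do rewrite lnV_expR.
under [X in X * _]eq_bigr do rewrite lnV_expR.
rewrite /damped -!expR_sum -expRD ler_expR -mulr_sumr !sumrN.
by rewrite mulNr -opprD lerN2.
Qed.

(** * Counting subgraphs and summing their weights *)

Lemma Kedge_inj (m n : nat) (e e' : Kedge m n) :
  later (tag e) = later (tag e') -> earlier e = earlier e' ->
  (tag e).2 = (tag e').2 -> e = e'.
Proof.
case: e e' => [[s a] i] [[s' a'] i'] /= ls + aa'.
have ss' : s = s' by apply: val_inj.
subst s' a' => /(congr1 val) /= ii'.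
by congr existT; apply: val_inj.
Qed.

(** An edge inside [X] is determined by its two endpoints and its label, which leaves at most
    [|X| ^ 2 * m] edges to choose from. *)
Lemma count_subgraphs (m n : nat) (X : {set 'I_n}) :
  (#|[set U : subgraph (K m n) | is_subgraph U && (U.1 == X)]| <= 2 ^ (#|X| ^ 2 * m))%N.
Proof.
pose EX := [set e : Kedge m n | @ends (K m n) e \subset X].
have cEX : (#|EX| <= #|X| ^ 2 * m)%N.
  pose f (e : Kedge m n) := ((later (tag e), earlier e), (tag e).2).
  have f_inj : injective f.
    move=> e e' ff; apply: Kedge_inj; last exact: (congr1 snd ff).
      exact: (congr1 (fst \o fst) ff).
    exact: (congr1 (snd \o fst) ff).
  rewrite -(card_imset _ f_inj).
  apply: leq_trans (_ : #|setX (setX X X) [set: 'I_m]| <= _)%N; last first.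
    by rewrite !cardsX cardsT card_ord.
  apply/subset_leq_card/subsetP=> _ /imsetP[e + ->]; rewrite !inE andbT => /subsetP eX.
  by rewrite !eX //= ?set21 ?set22.
apply: leq_trans (leq_pexp2l _ cEX) => //; rewrite -card_powerset.
rewrite -(@card_in_imset _ _ (fun U : subgraph (K m n) => U.2)); last first.
  move=> [V F] [V' F']; rewrite !inE /= => /andP[_ /eqP ->] /andP[_ /eqP ->] -> //.
apply/subset_leq_card/subsetP=> _ /imsetP[U + ->].
rewrite !inE => /andP[/forall_inP UF /eqP UX]; apply/subsetP=> e /UF.
by rewrite UX inE.
Qed.

Lemma card_fibers (I J : finType) (P : pred I) (Q : pred J) (f : I -> J) (M : nat) :
  (forall i, P i -> Q (f i)) ->
  (forall j, #|[set i | P i & f i == j]| <= M)%N ->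
  (#|[set i | P i]| <= #|[set j | Q j]| * M)%N.
Proof.
move=> PQ fib; rewrite cardsE -sum1_card (partition_big f Q) //=.
rewrite -sum_nat_const [leqRHS]big_mkcond [leqLHS]big_mkcond /=.
apply: leq_sum => j _; rewrite inE; case: ifP => // Qj.
by rewrite sum1_card; apply: leq_trans (fib j); rewrite cardsE.
Qed.

(** An indexed family with multiplicities at most [M] covers both single copies and unions of pairs
    of copies. *)
Lemma sum_wt_good (R : realType) (k t q m M : nat) :
  exists2 c : R, 0 < c & forall (n : nat) (I : finType) (Q : pred I) (U : I -> subgraph (K m n.+1)),
    (forall i, Q i -> exists Z C, good k t q (U i) Z C) ->
    (forall u, #|[set i | Q i & U i == u]| <= M)%N ->
    \sum_(i | Q i) wt R (U i).2 <= c * (2 + ln n.+1%:R) ^+ t.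
Proof.
(* [N] bounds the number of indices sharing one pair [(Z, C)]; its successor keeps the constant
   positive even for [M = 0]. *)
pose N := (2 ^ ((t + k) ^ 2 * m) * M)%N.
exists (N.+1%:R * (2 ^+ q * (1 + (1 + k.+1%:R)) ^+ k)) => [|n I Q U Ugood fib].
  by rewrite !(mulr_gt0, exprn_gt0, addr_gt0) ?ltr0n.
pose a (Z : {set 'I_n.+1}) : R := \prod_(v in Z) v.+1%:R^-1.
pose b (C : {set 'I_n.+1}) : R := \prod_(v in C) damped R k.+1 v.
have a0 Z : 0 <= a Z by apply: prodr_ge0 => v _; rewrite invr_ge0.
have b0 C : 0 <= b C by apply: prodr_ge0 => v _; apply: expR_ge0.
have ab0 Z C : 0 <= 2 ^+ q * (a Z * b C) by rewrite !mulr_ge0 ?exprn_ge0.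
(* Summing over all good pairs of [i] instead of choosing one only increases the bound and allows
   the sums to be exchanged. *)
apply: le_trans (_ : \sum_(i | Q i) \sum_(p : {set 'I_n.+1} * {set 'I_n.+1} | good k t q (U i) p.1 p.2)
    2 ^+ q * (a p.1 * b p.2) <= _).
  apply: ler_sum => i /Ugood[Z [C g]]; apply: le_trans (wt_good R g) _.
  by rewrite (bigD1 (Z, C)) //= lerDl; apply: sumr_ge0.
rewrite (exchange_big_dep (fun p : {set 'I_n.+1} * {set 'I_n.+1} => (#|p.1| <= t) && (#|p.2| <= k))%N) /=; last first.
  by move=> i p _ /and5P[_ _ _ -> /and3P[->]].
apply: le_trans (_ : \sum_(p : {set 'I_n.+1} * {set 'I_n.+1} | (#|p.1| <= t)%N && (#|p.2| <= k)%N)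
    N.+1%:R * (2 ^+ q * (a p.1 * b p.2)) <= _).
  apply: ler_sum => -[Z C] /= /andP[Zt Ck].
  rewrite sumr_const -[leLHS]mulr_natl; apply: ler_wpM2r => //.
  rewrite ler_nat (leq_trans _ (leqnSn _)) //.
  rewrite -cardsE.
  apply: leq_trans (@card_fibers _ _ (fun i => Q i && good k t q (U i) Z C)
    (fun u : subgraph (K m n.+1) => is_subgraph u && (u.1 == Z :|: C)) U M _ _) _.
  - by move=> i /andP[_ /and3P[-> ->]].
  - move=> u; apply: leq_trans (fib u); apply/subset_leq_card/subsetP=> i.
    by rewrite !inE => /andP[/andP[-> _]].
  rewrite leq_mul2r; apply/orP; right.
  apply: leq_trans (count_subgraphs m (Z :|: C)) _.
  rewrite leq_exp2l // leq_mul2r leq_sqr; apply/orP; right.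
  by rewrite cardsU; apply: leq_trans (leq_subr _ _) _; apply: leq_add.
rewrite -mulr_sumr -[leRHS]mulrA ler_wpM2l // -mulr_sumr -[leRHS]mulrA ler_wpM2l ?exprn_ge0 //.
rewrite -(pair_big (fun Z : {set 'I_n.+1} => #|Z| <= t)%N (fun C : {set 'I_n.+1} => #|C| <= k)%N (fun Z C => a Z * b C)) /=.
(* The double sum factors: the core sets contribute a constant, and the non-core sets a power of the
   harmonic sum. *)
rewrite -big_distrlr /= mulrC; apply: ler_pM; rewrite ?sumr_ge0 //.
- apply: le_trans (small_sets_sum _ _) _ => [v|]; first exact: expR_ge0.
  by rewrite lerXn2r ?nnegrE ?addr_ge0 ?sumr_ge0 ?lerD2l ?damped_sum // => v _; apply: expR_ge0.
- apply: le_trans (small_sets_sum _ _) _ => [v|]; first by rewrite invr_ge0.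
  have /(lerD (lexx 1)) := harmonic_le R n; rewrite addrA => h.
  rewrite lerXn2r ?nnegrE ?addr_ge0 ?sumr_ge0 ?ln_ge0 ?ler1n // => v _.
  by rewrite invr_ge0.
Qed.

(** * Copies and unions of two copies *)

Lemma copy_good (H : mgraph) (m n : nat) (S : subgraph (K m n)) :
  graph_connected H -> multicyclic H -> is_copy H S ->
  exists Z C, good #|vert H| #|(~: (two_core H).1)| #|edge H| S Z C.
Proof.
move=> cH mH /existsP[f /existsP[g /and5P[/injectiveP fi /eqP fS /injectiveP gi /eqP gS /forallP fg]]].
have {}fg e : ends (g e) = f @: ends e by apply/eqP.
exists (f @: (~: (two_core H).1)), (f @: (two_core H).1).
have fU : f @: (~: (two_core H).1) :|: f @: (two_core H).1 = S.1.
  by rewrite -fS -imsetU setUC setUCr.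
apply/and5P; split; rewrite ?fU //.
- apply/forall_inP=> e; rewrite -gS => /imsetP[e' _ ->].
  by rewrite fg -fS; apply: imsetS.
- rewrite -setI_eq0 -imsetI; last by move=> x y _ _; apply: fi.
  by rewrite setIC setICr imset0.
- by rewrite card_imset.
apply/and3P; split.
- by rewrite card_imset // max_card.
- by rewrite -gS card_imset // cardsT.
apply/forallP=> A; apply/implyP=> AS.
(* The growth property comes from [touch_card] for the preimage of [A], since [g] maps the edges
   touching the preimage injectively to edges touching [A]. *)
have fA : A = f @: (f @^-1: A).
  apply/setP=> v; apply/idP/imsetP => [vA|[x + ->]]; last by rewrite inE.
  have := subsetP AS v vA; rewrite -fS => /imsetP[x _ vx].
  by exists x; rewrite // inE -vx.
have := touch_card (f @^-1: A) cH mH.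
rewrite -(card_imset (f @^-1: A) fi) -fA -(card_imset (touch _ _) gi).
have -> : (f @^-1: A :&: (two_core H).1 != set0) = (A :&: f @: (two_core H).1 != set0).
  rewrite {2}fA -imsetI; last by move=> x y _ _; apply: fi.
  by rewrite imset_eq0.
move/leq_trans; apply; apply/subset_leq_card/subsetP=> _ /imsetP[e /touchP[_ [v ve]] + ->].
rewrite inE => vA; apply/touchP; split; first by rewrite -gS imset_f ?inE.
by exists (f v) => //; rewrite fg imset_f.
Qed.

Lemma copy_card (H G : mgraph) (S : subgraph G) :
  is_copy H S -> (#|S.1| <= #|vert H|)%N /\ (#|S.2| <= #|edge H|)%N.
Proof.
case/existsP=> f /existsP[g /and5P[_ /eqP <- _ /eqP <- _]].
by split; apply: leq_trans (leq_imset_card _ _) _; rewrite cardsT.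
Qed.

(** Edges of [S1] have both endpoints in [S1.1], so none of them touches [A :\: S1.1]. The counts
    for the two pieces of [A] therefore add up, and the surplus from [S1] survives. *)
Lemma touch_union (m n : nat) (S1 S2 : subgraph (K m n)) (A C1 : {set 'I_n}) :
  is_subgraph S1 ->
  (forall A : {set 'I_n}, A \subset S1.1 -> #|A| + (A :&: C1 != set0) <= #|touch S1.2 A|)%N ->
  (forall A : {set 'I_n}, A \subset S2.1 -> #|A| <= #|touch S2.2 A|)%N ->
  A \subset S1.1 :|: S2.1 ->
  (#|A| + (A :&: S1.1 :&: C1 != set0) <= #|touch (S1.2 :|: S2.2) A|)%N.
Proof.
move=> /forall_inP sub1 grow1 grow2 AU.
have := grow1 (A :&: S1.1) (subsetIr _ _).
have /grow2 : A :\: S1.1 \subset S2.1 by rewrite subDset.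
rewrite -(cardsID S1.1 A).
have : (#|touch S1.2 (A :&: S1.1)| + #|touch S2.2 (A :\: S1.1)| <= #|touch (S1.2 :|: S2.2) A|)%N.
  set T1 := touch S1.2 _; set T2 := touch S2.2 _.
  have := cardsUI T1 T2; rewrite (_ : T1 :&: T2 = set0) ?cards0 ?addn0.
    move=> <-; apply/subset_leq_card/subsetP=> e /setUP[]/touchP[eF [v ve]].
      by case/setIP=> vA _; apply/touchP; rewrite inE eF; split=> //; exists v.
    by case/setDP=> vA _; apply/touchP; rewrite inE eF orbT; split=> //; exists v.
  apply/setP=> e; rewrite in_set0; apply/negP=> /setIP[/touchP[/sub1/subsetP eS _]].
  by case/touchP=> _ [v /eS vS /setDP[_]]; rewrite vS.
move=> le12 le2 le1; apply: leq_trans le12; rewrite addnAC.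
exact: leq_add.
Qed.

(** A vertex that is core in either copy counts as core in the union, which leaves at most [t + t]
    non-core vertices. *)
Lemma union_good (m n k t q : nat) (S1 S2 : subgraph (K m n)) (Z1 C1 Z2 C2 : {set 'I_n}) :
  good k t q S1 Z1 C1 -> good k t q S2 Z2 C2 ->
  exists Z C, good (k + k) (t + t) (q + q)
    ((S1.1 :|: S2.1, S1.2 :|: S2.2) : subgraph (K m n)) Z C.
Proof.
case/and5P=> sub1 /eqP V1 _ Zt1 /and3P[Ck1 q1 /forallP grow1].
case/and5P=> sub2 /eqP V2 _ Zt2 /and3P[Ck2 q2 /forallP grow2].
have {}grow1 (A : {set 'I_n}) : A \subset S1.1 -> (#|A| + (A :&: C1 != set0) <= #|touch S1.2 A|)%N.
  exact: implyP (grow1 A).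
have {}grow2 (A : {set 'I_n}) : A \subset S2.1 -> (#|A| + (A :&: C2 != set0) <= #|touch S2.2 A|)%N.
  exact: implyP (grow2 A).
exists ((Z1 :|: Z2) :\: (C1 :|: C2)), (C1 :|: C2).
have cardU (T : finType) (P Q : {set T}) a b :
    (#|P| <= a -> #|Q| <= b -> #|P :|: Q| <= a + b)%N.
  by move=> Pa Qb; rewrite cardsU (leq_trans (leq_subr _ _)) // leq_add.
apply/and5P; split=> /=.
- apply/forall_inP=> e /setUP[/(forall_inP sub1)|/(forall_inP sub2)] /subset_trans; apply.
    exact: subsetUl.
  exact: subsetUr.
- by apply/eqP/setP=> v; rewrite V1 V2 !inE; do 4!case: (v \in _).
- by rewrite -setI_eq0 setIC setIDA setDIl setDv set0I.
- by apply: leq_trans (cardU _ _ _ _ _ Zt1 Zt2); apply/subset_leq_card/subsetDl.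
apply/and3P; split; [exact: cardU|exact: cardU|].
apply/forallP=> A; apply/implyP=> AU.
(* Count from [S1] or from [S2] according to which of the two cores meets [A]. *)
have u1 := touch_union sub1 grow1 (fun A AS => leq_trans (leq_addr _ _) (grow2 A AS)) AU.
have u2 := touch_union sub2 grow2 (fun A AS => leq_trans (leq_addr _ _) (grow1 A AS)).
rewrite setUC [S2.2 :|: _]setUC in u2; have {}u2 := u2 A AU.
have [_|/set0Pn[v /setIP[vA /setUP[vC|vC]]]] := eqVneq (A :&: (C1 :|: C2)) set0.
- by apply: leq_trans u1; rewrite addn0 leq_addr.
- suff E : A :&: S1.1 :&: C1 != set0 by rewrite E in u1.
  by apply/set0Pn; exists v; rewrite !inE vA vC V1 inE vC orbT.
- suff E : A :&: S2.1 :&: C2 != set0 by rewrite E in u2.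
  by apply/set0Pn; exists v; rewrite !inE vA vC V2 inE vC orbT.
Qed.

Lemma EW_le (R : realType) (H : mgraph) (m : nat) :
  graph_connected H -> multicyclic H ->
  exists2 c : R, 0 < c & forall n,
    EW R H m n.+1 <= c * (2 + ln n.+1%:R) ^+ #|(~: (two_core H).1)|.
Proof.
move=> cH mH; have [c c0 Hc] := sum_wt_good R #|vert H| #|(~: (two_core H).1)| #|edge H| m 1.
exists c => // n; rewrite EWE; apply: le_trans (ler_sum _ (fun S _ => expect_sub_le _ S.2)) _.
apply: (Hc n _ (fun S => is_copy H S) id) => [S|u]; first exact: copy_good.
apply: leq_trans (subset_leq_card (_ : _ \subset [set u])) _; last by rewrite cards1.
by apply/subsetP=> S; rewrite !inE => /andP[].
Qed.

Lemma VarW_bound (R : realType) (H : mgraph) (m : nat) :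
  graph_connected H -> multicyclic H ->
  exists2 c : R, 0 < c & forall n,
    `|VarW R H m n.+1| <= c * (2 + ln n.+1%:R) ^+ (2 * #|(~: (two_core H).1)|).
Proof.
move=> cH mH; set k := #|vert H|; set t := #|_|; set q := #|edge H|.
(* Both copies consist of subsets of the vertex set and of the edge set of their union, so [M]
   bounds the number of pairs with a given union. *)
pose M := (2 ^ (k + k) * 2 ^ (q + q) * (2 ^ (k + k) * 2 ^ (q + q)))%N.
have [c c0 Hc] := sum_wt_good R (k + k) (t + t) (q + q) m M.
exists c => // n; have /andP[v0] := VarW_le R H m n.+1.
rewrite ger0_norm // mul2n -addnn => /le_trans; apply.
pose U (S : subgraph (K m n.+1) * subgraph (K m n.+1)) : subgraph (K m n.+1) :=
  (S.1.1 :|: S.2.1, S.1.2 :|: S.2.2).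
apply: (Hc n (subgraph (K m n.+1) * subgraph (K m n.+1))%type
  (fun S => is_copy H S.1 && is_copy H S.2) U) => [[S1 S2] /= /andP[c1 c2]|u].
  have [Z1 [C1 g1]] := copy_good cH mH c1; have [Z2 [C2 g2]] := copy_good cH mH c2.
  exact: union_good g1 g2.
set T := [set i | _]; case: (set_0Vmem T) => [->|[[S1 S2]]]; first by rewrite cards0.
rewrite inE /= => /andP[/andP[/copy_card[v1 e1] /copy_card[v2 e2]] /eqP uE].
have cU (J : finType) (P Q : {set J}) a : (#|P| <= a -> #|Q| <= a -> #|P :|: Q| <= a + a)%N.
  by move=> Pa Qb; rewrite cardsU (leq_trans (leq_subr _ _)) // leq_add.
pose X := setX (powerset u.1) (powerset u.2).
apply: leq_trans (_ : #|setX X X| <= M)%N.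
  apply/subset_leq_card/subsetP=> -[[V1 F1] [V2 F2]].
  rewrite !inE /= => /andP[_ /eqP <-] /=.
  by rewrite !(subsetUl, subsetUr).
rewrite !cardsX !card_powerset -uE /M.
by rewrite !leq_mul // leq_exp2l // cU.
Qed.

(** * Lower bound *)

Lemma later_max (m n : nat) (e : edge (K m n)) (u : 'I_n) :
  u \in ends e -> (u <= later (tag e))%N.
Proof.
rewrite !inE => /orP[]/eqP-> //.
exact: ltnW (ltn_ord (tagged e)).
Qed.

Lemma later_ends (m n : nat) (e : edge (K m n)) : later (tag e) \in ends e.
Proof. by rewrite !inE eqxx. Qed.

Lemma later_eq (m n : nat) (e : edge (K m n)) (u : 'I_n) :
  u \in ends e -> (forall v, v \in ends e -> v <= u)%N -> later (tag e) = u.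
Proof.
move=> ue umax; apply: val_inj; apply/eqP.
by rewrite eqn_leq later_max // umax ?later_ends.
Qed.

Lemma Kedge_ends_inj (m n : nat) (e e' : edge (K m n)) :
  ends e = ends e' -> (tag e).2 = (tag e').2 -> e = e'.
Proof.
move=> ee' aa'; have ll' : later (tag e) = later (tag e').
  apply: later_eq => [|v]; first by rewrite ee' later_ends.
  by rewrite ee'; apply: later_max.
apply: Kedge_inj => //.
have : earlier e \in ends e' by rewrite -ee' !inE eqxx orbT.
rewrite !inE => /orP[]/eqP // E.
have : (earlier e < later (tag e))%N := ltn_ord (tagged e).
by rewrite ll' E ltnn.
Qed.

Lemma Kedge_exists (m n : nat) (X : {set 'I_n}) (a : 'I_m) :
  #|X| = 2 -> exists e : edge (K m n), ends e = X /\ (tag e).2 = a.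
Proof.
move/eqP/cards2P=> [x [y [xy ->]]]; wlog yx : x y xy / (y < x)%N.
  move=> wl; move: (xy); rewrite -val_eqE neq_ltn => /orP[]lt; last exact: wl.
  by rewrite setUC; apply: wl => //; rewrite eq_sym.
have x0 : (0 < x)%N by apply: leq_ltn_trans yx.
pose s : slot m n := (exist (fun j : 'I_n => 0 < j)%N x x0, a).
exists (existT (fun s : slot m n => 'I_(later s)) s (Ordinal yx)); split=> //.
by rewrite /= /later /=; congr [set _; _]; apply: val_inj.
Qed.

(* Charge every edge to its later endpoint: a core edge uses the same slot as in
   [S0], and a non-core vertex is the later endpoint of at most one edge. *)
Lemma placement (R : realType) (H : mgraph) (m n0 n : nat) (S0 : subgraph (K m n0))
    (f0 : vert H -> 'I_n0) (g0 : edge H -> edge (K m n0)) (rho : vert H -> nat)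
    (f : {ffun vert H -> 'I_n}) :
  let C := (two_core H).1 in
  injective f0 -> injective g0 -> (forall e, g0 e \in S0.2) ->
  (forall e, ends (g0 e) = f0 @: ends e) ->
  {in S0.2 &, injective (fun e : Kedge m n0 => tag e)} ->
  {in ~: C &, injective rho} ->
  {in ~: C, forall v, #|[set e | (v \in ends e) &&
      [forall u in ends e :\: C, rho u <= rho v]%N]| <= 1}%N ->
  {in C, forall v, f v = f0 v :> nat} ->
  {in ~: C, forall v, n0 <= f v}%N ->
  {in ~: C &, forall u v, (rho u < rho v)%N -> (f u < f v)%N} ->
  exists S : subgraph (K m n), [/\ is_copy H S, S.1 = f @: setT,
    {in S.2 &, injective (fun e : Kedge m n => tag e)} &
    n0%:R ^- #|edge H| * \prod_(v in ~: C) (f v)%:R^-1 <= wt R S.2].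
Proof.
move=> C f0i g0i g0S fg0 tag0 rhoi rho1 fC fn0 frho.
have fi : injective f.
  move=> u v fuv; have [uC|uC] := boolP (u \in C); have [vC|vC] := boolP (v \in C).
  - by apply: f0i; apply: val_inj; rewrite /= -!fC ?fuv.
  - have := fn0 v; rewrite inE vC -fuv fC // => /(_ isT).
    by rewrite leqNgt ltn_ord.
  - have := fn0 u; rewrite inE uC fuv fC // => /(_ isT).
    by rewrite leqNgt ltn_ord.
  - have uC' : u \in ~: C by rewrite inE.
    have vC' : v \in ~: C by rewrite inE.
    apply: rhoi => //; apply/eqP; rewrite eqn_leq.
    by apply/andP; split; rewrite leqNgt; apply/negP=> /frho; rewrite fuv ltnn => /(_ _ _)/negP; apply.
have /fin_all_exists[g gP] : forall e : edge H, exists e' : edge (K m n),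
    ends e' = f @: ends e /\ (tag e').2 = (tag (g0 e)).2.
  by move=> e; apply: Kedge_exists; rewrite card_imset // ends_card.
have fg e : ends (g e) = f @: ends e by case: (gP e).
have lab e : (tag (g e)).2 = (tag (g0 e)).2 by case: (gP e).
have gi : injective g.
  move=> e e' gee'; apply: g0i; apply: Kedge_ends_inj; last by rewrite -!lab gee'.
  have ee' : ends e = ends e' by apply: (imset_inj fi); rewrite -!fg gee'.
  by rewrite !fg0 ee'.
have /fin_all_exists[top topP] : forall e : edge H, exists v,
    v \in ends e /\ later (tag (g e)) = f v.
  move=> e; have := later_ends (g e); rewrite fg => /imsetP[v ve ->].
  by exists v.
have top_ends e : top e \in ends e by case: (topP e).
have top_later e : later (tag (g e)) = f (top e) by case: (topP e).
have top_max e u : u \in ends e -> (f u <= f (top e))%N.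
  by move=> ue; rewrite -top_later; apply: later_max; rewrite fg imset_f.
(* Since [f] respects the ranks, a non-core top endpoint has the highest rank among the non-core
   endpoints, so [e] is the one edge that [rho1] permits. *)
have peel e : top e \notin C -> e \in [set e' | (top e \in ends e') &&
      [forall u in ends e' :\: C, rho u <= rho (top e)]%N].
  move=> tC; rewrite inE top_ends; apply/forall_inP=> u /setDP[ue uC].
  rewrite leqNgt; apply/negP=> /frho; rewrite !inE uC tC => /(_ isT isT).
  by rewrite ltnNge top_max.
have top_inj e e' : top e \notin C -> top e = top e' -> e = e'.
  move=> tC tt; have := rho1 (top e); rewrite inE tC => /(_ isT) /card_le1_eqP; apply.
  by rewrite tt; apply: peel; rewrite -tt.
  exact: peel.
(* Non-core positions start at [n0], so an edge whose top endpoint is in the core has both endpoints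
   there, in the same order as in [S0]. *)
have core e : top e \in C -> later (tag (g0 e)) = f0 (top e).
  move=> tC; apply: later_eq; rewrite fg0 ?imset_f // => _ /imsetP[u ue ->].
  have := top_max e u ue; rewrite (fC _ tC).
  have [uC|uC] := boolP (u \in C); first by rewrite fC.
  by move/(leq_trans (fn0 u _)); rewrite inE uC leqNgt ltn_ord => /(_ isT).
have tagi e e' : tag (g e) = tag (g e') -> e = e'.
  move=> tt; have ft : top e = top e' by apply: fi; rewrite -!top_later tt.
  have [tC|tC] := boolP (top e \in C); last exact: top_inj.
  apply: g0i; apply: tag0 => //.
  have l0 : later (tag (g0 e)) = later (tag (g0 e')) by rewrite !core // -ft.
  have a0 : (tag (g0 e)).2 = (tag (g0 e')).2 by rewrite -!lab tt.
  move: l0 a0; case: (tag (g0 e)) => s a; case: (tag (g0 e')) => s' a' /= ls ->.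
  by congr (_, _); apply: val_inj.
exists ((f @: setT, g @: setT) : subgraph (K m n)); split=> //=.
- apply/existsP; exists f; apply/existsP; exists (finfun g).
  apply/and5P; split=> //; first exact/injectiveP.
  + by apply/injectiveP => e e'; rewrite !ffunE; apply: gi.
  + by apply/eqP; apply: eq_imset => e; rewrite ffunE.
  + by apply/forallP=> e; rewrite ffunE fg.
- by move=> _ _ /imsetP[e _ ->] /imsetP[e' _ ->] /tagi ->.
rewrite /wt big_imset /=; last by move=> e e' _ _; apply: gi.
(* Edges outside [T] have weight at least [1 / n0]. Edges in [T] have distinct non-core tops, and a
   non-core vertex that is no top only brings a factor at most 1 to the left-hand side. *)
pose T := [set e | top e \notin C].
have inv1 (k : nat) : k%:R^-1 <= 1 :> R.
  by case: k => [|k]; rewrite ?invr0 ?ler01 // invf_le1 ?ltr0n // ler1n.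
rewrite (big_setID (~: T)) /= setTI setTD setCK; apply: ler_pM; rewrite ?invr_ge0 ?exprn_ge0 //.
- by apply: prodr_ge0 => v _; rewrite invr_ge0.
- apply: le_trans (_ : \prod_(e in ~: T) n0%:R^-1 <= _).
    rewrite prodr_const -exprVn; apply: ler_wiXn2l; rewrite ?invr_ge0 ?inv1 //.
    exact: max_card.
  apply: ler_prod => e; rewrite inE inE negbK => tC; rewrite invr_ge0 ler0n /=.
  rewrite lef_pV2 ?posrE ?ltr0n ?later_gt0 //.
    by rewrite ler_nat top_later fC // ltnW.
  exact: leq_ltn_trans (ltn_ord (f0 (top e))).
under [leRHS]eq_bigr do rewrite top_later.
have topT : {in T &, injective top}.
  by move=> e e'; rewrite inE => tC _; apply: top_inj.
rewrite -(big_imset (fun v => (f v)%:R^-1) topT) /=.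
have TC : top @: T \subset ~: C by apply/subsetP=> _ /imsetP[e + ->]; rewrite !inE.
rewrite (big_setID (top @: T)) /= (setIidPr TC) ler_piMr //.
  by apply: prodr_ge0 => v _; rewrite invr_ge0.
by apply: prodr_ile1 => v _; rewrite invr_ge0 ler0n inv1.
Qed.

(** Each of the [s] intervals from [2 ^ b] to [2 ^ (b + 1)] contributes at least [1 / 2]. *)
Lemma dyadic_sum (R : realType) (a s n : nat) : (2 ^ (a + s) <= n)%N ->
  s%:R / 2 <= \sum_(j < n | (2 ^ a <= j < 2 ^ (a + s))%N) j%:R^-1 :> R.
Proof.
move=> le_n; have -> : \sum_(j < n | (2 ^ a <= j < 2 ^ (a + s))%N) j%:R^-1 =
    \sum_(2 ^ a <= j < 2 ^ (a + s)) j%:R^-1 :> R.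
  rewrite -(big_mkord (fun j => 2 ^ a <= j < 2 ^ (a + s))%N (fun j => j%:R^-1)).
  by rewrite [RHS](big_nat_widenl _ 0%N) // [RHS](big_nat_widen _ _ n).
elim: s {n le_n} => [|s IHs]; first by rewrite mul0r addn0 big_geq.
rewrite addnS (big_cat_nat (n := 2 ^ (a + s))) ?leq_exp2l ?leq_addr ?leqnSn //=.
rewrite -[s.+1]addn1 natrD mulrDl; apply: lerD => //.
apply: le_trans (_ : \sum_(2 ^ (a + s) <= j < 2 ^ (a + s).+1) (2 ^ (a + s).+1)%:R^-1 <= _).
  rewrite sumr_const_nat expnS mul2n -addnn addnK addnn -mul2n.
  by rewrite -[leRHS]mulr_natr natrM invfM -mulrA mulVf ?mulr1 ?mul1r // pnatr_eq0 expn_eq0.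
rewrite [leLHS]big_nat_cond [leRHS]big_nat_cond; apply: ler_sum => j; rewrite andbT => /andP[le_j lt_j].
have j0 : (0 < j)%N by apply: leq_trans le_j; rewrite expn_gt0.
by rewrite lef_pV2 ?posrE ?ltr0n ?expn_gt0 // ler_nat ltnW.
Qed.

(** [s] is the number of dyadic intervals in the block of each non-core vertex, and [n0 <= 2 ^ N]
    puts all blocks beyond the fixed core. *)
Lemma EW_ge (R : realType) (H : mgraph) (m n0 N s n : nat) (S0 : subgraph (K m n0)) :
  potential_copy H S0 -> (n0 <= 2 ^ N)%N ->
  (2 ^ (N + s * #|(~: (two_core H).1)|) <= n)%N ->
  n0%:R ^- #|edge H| * (s%:R / 2) ^+ #|(~: (two_core H).1)| <= EW R H m n.
Proof.
set C := (two_core H).1; case=> + tag0 n0N len.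
rewrite inE => /andP[_ /existsP[f0 /existsP[g0 /and5P[/injectiveP f0i _ /injectiveP g0i /eqP g0S /forallP fg0]]]].
have {}fg0 e : ends (g0 e) = f0 @: ends e by apply/eqP.
have {}g0S e : g0 e \in S0.2 by rewrite -g0S imset_f ?inE.
have [rho [rho_lt rho_inj rho_deg]] := peeling (subsetT C).
rewrite setTD in rho_lt rho_inj rho_deg.
have {}rho_deg : {in ~: C, forall v, #|[set e | (v \in ends e) &&
      [forall u in ends e :\: C, rho u <= rho v]%N]| <= 1}%N.
  move=> v vC; apply: leq_trans (rho_deg v vC); apply/subset_leq_card/subsetP=> e.
  by rewrite !inE subsetT.
pose lo v := (2 ^ (N + s * rho v))%N.
have hi_n v : v \in ~: C -> (lo v * 2 ^ s <= n)%N.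
  move=> vC; rewrite -expnD -addnA -mulnSr (leq_trans _ len) // leq_exp2l // leq_add2l.
  by rewrite leq_mul2l rho_lt ?orbT.
(* Core vertices stay put, and the other ones range over disjoint blocks ordered
   like [rho]. *)
pose Q (v : vert H) : pred 'I_n := fun j =>
  if v \in C then j == f0 v :> nat else (lo v <= j < lo v * 2 ^ s)%N.
have QC f : f \in family Q -> {in C, forall v, (f v : nat) = f0 v}.
  by move=> /familyP fQ v vC; have := fQ v; rewrite unfold_in /Q vC => /eqP.
have QnC f : f \in family Q -> {in ~: C, forall v, lo v <= f v < lo v * 2 ^ s}%N.
  by move=> /familyP fQ v; rewrite inE => vC; have := fQ v; rewrite unfold_in /Q (negPf vC).
have lo_mono u v : (rho u < rho v)%N -> (lo u * 2 ^ s <= lo v)%N.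
  by move=> uv; rewrite -expnD leq_exp2l // -addnA -mulnSr leq_add2l leq_mul2l uv orbT.
have /fin_all_exists[S SP] : forall f : {ffun vert H -> 'I_n}, exists S : subgraph (K m n),
    f \in family Q -> [/\ is_copy H S, S.1 = f @: setT,
    {in S.2 &, injective (fun e : Kedge m n => tag e)} &
    n0%:R ^- #|edge H| * \prod_(v in ~: C) (f v)%:R^-1 <= wt R S.2].
  move=> f; have [fQ|_] := boolP (f \in family Q); last by exists (set0, set0).
  have [S SP] : exists S : subgraph (K m n), [/\ is_copy H S, S.1 = f @: setT,
      {in S.2 &, injective (fun e : Kedge m n => tag e)} &
      n0%:R ^- #|edge H| * \prod_(v in ~: C) (f v)%:R^-1 <= wt R S.2].
    apply: (placement R f0i g0i g0S fg0 tag0 rho_inj rho_deg (QC f fQ)) => [v vC|u v uC vC uv].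
      have /andP[+ _] := QnC f fQ v vC; apply: leq_trans; apply: leq_trans n0N _.
      by rewrite leq_exp2l // leq_addr.
    have /andP[_ fu] := QnC f fQ u uC; have /andP[fv _] := QnC f fQ v vC.
    exact: leq_trans fu (leq_trans (lo_mono _ _ uv) fv).
  by exists S.
(* The blocks are disjoint and lie beyond the core, so the vertex set of [S f] already determines
   [f]. *)
have S_inj : {in family Q &, injective S}.
  move=> f f' fQ f'Q SS; apply/ffunP => v; apply: val_inj => /=.
  have [vC|vC] := boolP (v \in C); first by rewrite (QC f) // (QC f').
  have [_ Sf _ _] := SP f fQ; have [_ Sf' _ _] := SP f' f'Q.
  have vC' : v \in ~: C by rewrite inE.
  have /andP[fl fu] := QnC f fQ v vC'.
  have : f v \in f' @: setT by rewrite -Sf' -SS Sf imset_f.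
  case/imsetP=> u _ E; rewrite E; congr (nat_of_ord (f' _)).
  have [uC|uC] := boolP (u \in C).
    move: fl; rewrite E (QC f' f'Q u uC) leqNgt.
    rewrite (leq_trans (ltn_ord _)) // (leq_trans n0N) // leq_exp2l // leq_addr //.
  have uC' : u \in ~: C by rewrite inE.
  have /andP[fl' fu'] := QnC f' f'Q u uC'; rewrite -E in fl' fu'.
  apply: rho_inj => //; apply/eqP; rewrite eqn_leq; apply/andP; split; rewrite leqNgt.
    apply/negP=> /lo_mono le; have := leq_trans fu (leq_trans le fl').
    by rewrite ltnn.
  apply/negP=> /lo_mono le; have := leq_trans fu' (leq_trans le fl).
  by rewrite ltnn.
have ES F : 0 <= expect (fun w : outcome m n => (F \subset (UA w).2)%:R) :> R.
  apply: sumr_ge0 => w _; rewrite mulr_ge0 //.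
  by apply: prodr_ge0 => i _; rewrite invr_ge0.
rewrite EWE; apply: le_trans (_ : \sum_(S' in S @: family Q)
    expect (fun w : outcome m n => (S'.2 \subset (UA w).2)%:R) <= _); last first.
  rewrite big_mkcond [leRHS]big_mkcond; apply: ler_sum => S' _.
  case: ifPn => [/imsetP[f fQ ->]|_]; last by case: ifP.
  by have [-> _ _ _] := SP f fQ.
rewrite big_imset //=.
apply: le_trans (_ : \sum_(f in family Q) n0%:R ^- #|edge H| * \prod_(v in ~: C) (f v)%:R^-1 <= _); last first.
  by apply: ler_sum => f fQ; have [_ _ tagS] := SP f fQ; rewrite (expect_sub _ tagS).
rewrite -mulr_sumr ler_wpM2l ?invr_ge0 ?exprn_ge0 //.
pose x v (j : 'I_n) : R := if v \in ~: C then j%:R^-1 else 1.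
under eq_bigr do rewrite big_mkcond.
(* The sum over [family Q] factors over the vertices: a core vertex contributes 1, any other one the
   harmonic mass of its block. *)
rewrite -(bigA_distr_big_dep Q x) (bigID (mem C)) /=.
rewrite big1 ?mul1r => [|v vC].
  rewrite -prodr_const [leRHS](eq_bigl (mem (~: C))) => [|v]; last by rewrite !inE.
  apply: ler_prod => v vC; rewrite divr_ge0 ?ler0n //=.
  apply: le_trans (dyadic_sum R (n := n) (a := N + s * rho v) (s := s) _) _.
    by rewrite expnD; apply: hi_n.
  rewrite /x vC; move: vC; rewrite inE => vC.
  rewrite big_mkcond [leRHS]big_mkcond; apply: ler_sum => j _.
  by rewrite /Q (negPf vC) /lo -expnD.
have lt_n : (f0 v < n)%N.
  apply: leq_trans (ltn_ord _) (leq_trans n0N (leq_trans _ len)).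
  by rewrite leq_exp2l // leq_addr.
rewrite (big_pred1 (Ordinal lt_n)) => [|j]; first by rewrite /x inE vC.
by rewrite /Q vC /= -val_eqE.
Qed.

(** * Passage to powers of the logarithm *)

Lemma ln_le_trunc_log (R : realType) (n : nat) :
  (0 < n)%N -> ln n%:R <= (trunc_log 2 n).+1%:R :> R.
Proof.
move=> n0; apply: le_trans (_ : ln (2 ^+ (trunc_log 2 n).+1) <= _).
  rewrite ler_ln ?posrE ?ltr0n ?exprn_gt0 // -natrX ler_nat.
  exact: ltnW (trunc_log_ltn _ _).
rewrite lnXn //; apply: ler_wMn2r.
by have := @le_ln1Dx R 1; rewrite -[1 + 1]/(2%:R); apply; lra.
Qed.

Lemma EW_lower (R : realType) (H : mgraph) (m n0 : nat) (S0 : subgraph (K m n0)) :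
  (0 < n0)%N -> potential_copy H S0 ->
  exists2 c : R, 0 < c & exists N : nat, forall n, (N <= n)%N ->
    c * ln n%:R ^+ #|(~: (two_core H).1)| <= EW R H m n.
Proof.
move=> n0_gt0 pS0; set t := #|_|.
have n0N : (n0 <= 2 ^ n0)%N by apply/ltnW/ltn_expl.
pose M := (n0 + t)%N.
(* The factor [4 * (t + 1)] comes from [ln n <= L + 1 <= 4 * (t + 1) * (s / 2)] for [t > 0], with
   [L] and [s] as below. *)
exists (n0%:R ^- #|edge H| * (4 * t.+1%:R) ^- t).
  by rewrite mulr_gt0 // invr_gt0 exprn_gt0 ?ltr0n // mulr_gt0 ?ltr0n.
(* This threshold gives [L > 2 * (n0 + t)], so the losses from [n0] and from rounding stay below
   half of [L]. *)
exists (2 ^ (2 * M).+1)%N => n le_n.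
have n_gt0 : (0 < n)%N by apply: leq_trans le_n; rewrite expn_gt0.
have le_L : ((2 * M).+1 <= trunc_log 2 n)%N by apply: trunc_log_max.
have le_Ln : (2 ^ trunc_log 2 n <= n)%N by apply: trunc_logP.
move: (ln_le_trunc_log R n_gt0) le_L le_Ln; set L := trunc_log 2 n => lnL le_L le_Ln.
(* The exponents from [n0] to [L] are shared equally among [t] blocks. For [t = 0] the quotient is
   0, but then both powers equal 1. *)
pose s := ((L - n0) %/ t)%N.
have st : (s * t <= L - n0)%N by apply: leq_trunc_div.
apply: le_trans (EW_ge R pS0 n0N (s := s) _); last first.
  by apply: leq_trans le_Ln; rewrite leq_exp2l // -/t; lia.
rewrite -/t -mulrA ler_wpM2l ?invr_ge0 ?exprn_ge0 // -exprVn -exprMn.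
have [t0|t_gt0] := posnP t; first by rewrite t0 !expr0.
have ln0 : 0 <= ln n%:R :> R by rewrite ln_ge0 // ler1n.
apply: lerXn2r; rewrite ?nnegrE ?divr_ge0 ?mulr_ge0 ?invr_ge0 ?ler0n ?mulr_ge0 ?ler0n //.
rewrite ler_pdivrMl ?mulr_gt0 ?ltr0n //; apply: le_trans lnL _.
have -> : 4 * t.+1%:R * (s%:R / 2) = (2 * t.+1 * s)%:R :> R.
  by rewrite !natrM; lra.
rewrite ler_nat.
have : (L - n0 < s * t + t)%N by rewrite -mulSnr -ltn_divLR.
rewrite /M in le_L; nia.
Qed.

Lemma ln_ge1 (R : realType) (n : nat) : (4 <= n)%N -> 1 <= ln n%:R :> R.
Proof.
move=> n4; apply: le_trans (_ : ln (2 ^+ 2) <= _).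
  (* [lnS_diff] at 0 gives [ln 2 >= 1 / 2]. *)
  by rewrite lnXn //; have := lnS_diff R 0; rewrite ln1; lra.
by rewrite ler_ln ?posrE ?ltr0n ?exprn_gt0 // -?natrX ?ler_nat //; apply: leq_trans n4.
Qed.

Lemma pow_ln_absorb (R : realType) (n t : nat) : (4 <= n)%N ->
  (2 + ln n%:R) ^+ t <= 3 ^+ t * ln n%:R ^+ t :> R.
Proof.
move=> /(ln_ge1 R) l1; rewrite -exprMn; apply: lerXn2r; rewrite ?nnegrE; lra.
Qed.

Local Open Scope classical_set_scope.
Local Open Scope ring_scope.

Theorem theorem3p13 (R : realType) (H : mgraph) (mH m t : nat) :
  graph_connected H -> multicyclic H ->
  is_mH H mH -> (0 < m)%N -> (mH <= m)%N ->
  t = #|(~: (two_core H).1)%SET| ->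
  is_Theta (fun n : nat => EW R H m n) (fun n : nat => ln (n%:R : R) ^+ t) /\
  (fun n : nat => VarW R H m n : R^o) =O_\oo
    (fun n : nat => ln (n%:R : R) ^+ (2 * t) : R^o).
Proof.
(* The assumption on [mH] provides the potential copy for the lower bound; [N0.+1] makes its number
   of available positions positive. *)
move=> connH multiH [_ _ /(_ m) exS] _ /exS[N0 /(_ N0.+1 (leqnSn _))[S0 pS0]] ->.
set t0 := #|_|; split.
  have [c c0 [N1 low]] := EW_lower R (ltn0Sn N0) pS0.
  have [C C0 up] := EW_le R m connH multiH.
  (* The maximum enforces the condition [c <= C] of [is_Theta]. *)
  exists c, (Num.max c (C * 3 ^+ t0)); split=> //; first by rewrite le_max lexx.
  exists (maxn N1 4) => n; rewrite geq_max => /andP[/low -> /=].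
  case: n => // n n4; apply: le_trans (up n) _.
  apply: le_trans (ler_wpM2l (ltW C0) (pow_ln_absorb R _ n4)) _.
  rewrite mulrA; apply: ler_wpM2r; last by rewrite le_max lexx orbT.
  by rewrite exprn_ge0 // (le_trans ler01) // ln_ge1.
have [C C0 up] := VarW_bound R m connH multiH.
apply/eqO_exP; exists (C * 3 ^+ (2 * t0)); first by rewrite mulr_gt0 ?exprn_gt0.
exists 4%N => // -[//|n] /= n4; apply: le_trans (up n) _.
apply: le_trans (ler_wpM2l (ltW C0) (pow_ln_absorb R _ n4)) _.
by rewrite mulrA; apply: ler_wpM2l (ler_norm _); rewrite mulr_ge0 ?exprn_ge0 ?ltW.
Qed.
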